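(* Let $K>0$ and let $(\lambda_t)_{t\ge 1}$ be the sequence generated by the projected stochastic gradient descent recurrence $$\lambda_{t+1}=\Pi_\Lambda\left(\lambda_t-\eta_t\left(b-N R_{\xi_{t+1}}\overline x^{\xi_{t+1}}(\lambda_t)\right)\right),\quad t\ge 1,\qquad \lambda_1\in\Lambda,$$ with $\eta_t=K/\sqrt t$, where all objects are as in the context. Put $\overline\lambda_T=\frac1T\sum_{t=1}^T\lambda_t$ and $$D=\frac{mB^2}{2K}+KL^2,\qquad L=\left(\sum_{j=1}^m\max\left\{b^j,\frac{B}{\sigma}-b^j\right\}^2\right)^{1/2}.$$ Then for every $T\ge 1$: $$\mathsf E\left(\sum_{i=1}^N R_i^j\,\overline x^i(\overline\lambda_T)-b^j\right)^+\le\sqrt{\frac{2D}{\sigma}}\,\frac{1}{T^{1/4}},\qquad j=1,\dots,m,$$ $$u(x^* )-\mathsf E\,u(\overline x(\overline\lambda_T))\le B\sqrt{\frac{2D}{\sigma}}\,\frac{1}{T^{1/4}}.$$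
   Context: Network. Let $m,N\ge 1$ be integers (numbers of links and of users). The routing matrix $R=(R_i^j)\in\mathbb R^{m\times N}$ has columns $R_i=(R_i^1,\dots,R_i^m)\in\{0,1\}^m$, $R_i\ne 0$, $i=1,\dots,N$. The capacity vector $b\in\mathbb R^m$ has strictly positive components $b^j$. Lower indices number vectors, upper indices number components; $\langle\cdot,\cdot\rangle$ and $\|\cdot\|$ are the Euclidean scalar product and norm; $y^+=\max\{y,0\}$ for real $y$; $\mathbb R_+=[0,\infty)$; vector inequalities are componentwise. Standing assumptions on the utility functions $u_i$, with constants $B>0$, $\sigma>0$, $\varepsilon>0$: for each $i=1,\dots,N$, $u_i$ is twice continuously differentiable on $(-\varepsilon,\infty)$, $u_i(0)=0$, $0<u_i'(0)\le B<\infty$, and $-u_i''(y)\ge N\sigma$ for all $y\in\mathbb R_+$. Primal problem: maximize $u(x)=\sum_{i=1}^N u_i(x^i)$ over $x=(x^1,\dots,x^N)\in\mathbb R_+^N$ subject to $\sum_{i=1}^N R_i x^i\le b$; $x^*$ denotes its (unique) optimal solution. User reactions: for $\lambda\in\mathbb R_+^m$, $\overline x^i(\lambda)$ is the unique maximizer of $u_i(y)-\langle\lambda,R_i\rangle y$ over $y\in\mathbb R_+$, and $\overline x(\lambda)=(\overline x^1(\lambda),\dots,\overline x^N(\lambda))$. Algorithm: $\Lambda=[0,B]^m$, and $\Pi_\Lambda$ is the orthogonal projection of $\mathbb R^m$ onto $\Lambda$ (componentwise truncation to $[0,B]$). $(\xi_r)_{r\ge 1}$ is a sequence of independent random variables on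 a probability space $(\Omega,\mathscr F,\mathsf P)$, each uniformly distributed on $\{1,\dots,N\}$; $\mathsf E$ is the expectation. The initial point $\lambda_1\in\Lambda$ is deterministic. *)

(* Defs.v *)
From mathcomp Require Import all_boot all_order all_algebra finmap.
From mathcomp Require Import all_classical all_reals all_analysis.

Set Implicit Arguments.
Unset Strict Implicit.
Unset Printing Implicit Defensive.

Import Order.TTheory GRing.Theory Num.Theory.
Import numFieldNormedType.Exports.

Local Open Scope ring_scope.
Local Open Scope classical_set_scope.

(* All vectors are columns: [x j 0] is the component x^j, [col i A] is R_i. *)

Definition dotv (R : realType) (n : nat) (x y : 'cV[R]_n) : R :=
  \sum_(j < n) x j 0 * y j 0.

(* The library norm on matrices is the sup norm, not the Euclidean one. *)
Definition enorm (R : realType) (n : nat) (x : 'cV[R]_n) : R :=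
  Num.sqrt (dotv x x).

Definition nonnegv (R : realType) (n : nat) : set 'cV[R]_n :=
  [set x | forall j, 0 <= x j 0].

Definition box (R : realType) (n : nat) (B : R) : set 'cV[R]_n :=
  [set x | forall j, 0 <= x j 0 <= B].

Definition is_maximizer (R : realType) (T : Type) (S : set T) (f : T -> R)
    (x : T) : Prop :=
  S x /\ forall y, S y -> f y <= f x.

(* A maximizer of [f] on [S]; 0 is a junk value, returned only if there is
   none. *)
Definition argmax (R : realType) (T : zmodType) (S : set T) (f : T -> R) : T :=
  xget 0 [set x | is_maximizer S f x].

(* Orthogonal projection: the point of [S] closest to [x]. *)
Definition orth_proj (R : realType) (n : nat) (S : set 'cV[R]_n)
    (x : 'cV[R]_n) : 'cV[R]_n :=
  argmax S (fun y => - enorm (x - y)).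

Definition C2_on (R : realType) (S : set R) (f : R -> R) : Prop :=
  forall y, S y ->
    [/\ derivable f y 1, derivable f^`() y 1 & {for y, continuous f^`(2)}].

Definition total_utility (R : realType) (N : nat) (u : 'I_N -> R -> R)
    (x : 'cV[R]_N) : R :=
  \sum_(i < N) u i (x i 0).

(* [(A *m x) j 0] is the load \sum_i R_i^j x^i of link j. *)
Definition feasible (R : realType) (m N : nat) (A : 'M[R]_(m, N))
    (b : 'cV[R]_m) : set 'cV[R]_N :=
  [set x | nonnegv x /\ forall j, (A *m x) j 0 <= b j 0].

Definition primal_opt (R : realType) (m N : nat) (A : 'M[R]_(m, N))
    (b : 'cV[R]_m) (u : 'I_N -> R -> R) : 'cV[R]_N :=
  argmax (feasible A b) (total_utility u).

Definition reaction (R : realType) (m N : nat) (A : 'M[R]_(m, N))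
    (u : 'I_N -> R -> R) (i : 'I_N) (lam : 'cV[R]_m) : R :=
  argmax [set y : R | 0 <= y] (fun y => u i y - dotv lam (col i A) * y).

Definition reactions (R : realType) (m N : nat) (A : 'M[R]_(m, N))
    (u : 'I_N -> R -> R) (lam : 'cV[R]_m) : 'cV[R]_N :=
  \col_(i < N) reaction A u i lam.

(* Random elements of a finite set carry the full powerset as sigma-algebra, so
   all events [X @^-1` S] are required to be measurable. *)
Definition finite_random_element (d : measure_display)
    (Omega : measurableType d) (E : finType) (X : Omega -> E) : Prop :=
  forall S : set E, measurable (X @^-1` S).

Definition mutually_independent (R : realType) (d : measure_display)
    (Omega : measurableType d) (P : probability Omega R) (E : finType)
    (I : choiceType) (D : set I) (X : I -> Omega -> E) : Prop :=
  forall (J : {fset I}) (S : I -> set E),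
    [set` J] `<=` D ->
    P (\bigcap_(r in [set` J]) (X r @^-1` S r))
    = (\prod_(r <- J) P (X r @^-1` S r))%E.

Definition uniformly_distributed (R : realType) (d : measure_display)
    (Omega : measurableType d) (P : probability Omega R) (E : finType)
    (X : Omega -> E) : Prop :=
  forall e : E, P (X @^-1` [set e]) = (#|E|%:R^-1)%:E.

(* Main.v *)
Require Import Defs.
From mathcomp Require Import all_boot all_order all_algebra finmap.
From mathcomp Require Import all_classical all_reals all_analysis.
From mathcomp Require Import ring lra zify.

Import Order.TTheory GRing.Theory Num.Theory.
Import numFieldNormedType.Exports.

Local Open Scope ring_scope.
Local Open Scope classical_set_scope.

(** Write [R_i = col i A], and let [dual lam] be the Lagrangian dual function of
    the primal problem, whose inner maxima are attained by the reactions
    [x_i(lam)]. Three facts give the two bounds.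

    Duality. [b - sum_i x_i(lam) R_i] is a subgradient of the dual function
    ([dual_subgradient]), and it is Lipschitz in [lam] because demand is
    Lipschitz in prices ([dual_grad_lipschitz]). Hence the dual function is
    continuous and has a minimizer [opt] on the box, where a variational
    inequality holds. The bound [B] on the multipliers is not active: at price
    [B] nobody uses a link, so the link is not congested. The variational
    inequality therefore amounts to feasibility and complementary slackness
    ([dual_opt_feasible], [dual_opt_complementary]), and the reactions to [opt]
    solve the primal problem with no duality gap ([strong_duality]). As the
    utilities are strongly concave with modulus [c = N sigma], weak duality at
    any other [lam] leaves the margin
    [c / 2 * sum_i (x_i(opt) - x_i(lam))^2 <= dual lam - dual opt]
    ([reactions_error]).

    Errors. Both the overload of a link and the loss of utility, the latter up
    to the factor [B], are at most [sum_i |x_i(opt) - x_i(lam)|]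
    ([link_overload], [utility_shortfall]).

    Stochastic descent. One step from [lam] decreases the expected squared
    distance to [opt] by at least [2 eta (dual lam - dual opt) - eta^2 L^2]
    ([sgd_expected_step]). Summing over the steps and applying Jensen's
    inequality bounds the expected dual gap of the averaged iterate by
    [D / sqrt T] ([sgd_average_gap]). The expected l^1 error is then at most
    [sqrt (2 D / (sigma sqrt T))] ([sgd_demand_error]).

    The averaged iterate is a function of finitely many draws, and by
    independence every history of draws of length [T] has probability [N^-T]
    ([expectation_history]). So each expectation is an average over the finite
    set of histories, and the descent argument is carried out for such
    averages, by induction on the length of the history. *)

(** * Euclidean geometry *)

(** Turns a comparison along a segment into a first-order condition at its
    endpoint. *)
Lemma le0_of_le_small (R : realType) (a b : R) :
  (forall t, 0 < t < 1 -> a <= t * b) -> a <= 0.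
Proof.
move=> h; rewrite leNgt; apply/negP => a0.
have [b0|b0] := leP b 0.
  have /h : 0 < (2^-1 : R) < 1 by lra.
  by lra.
have t0 : 0 < a / (a + b + b) by rewrite divr_gt0//; lra.
have t1 : a / (a + b + b) < 1 by rewrite ltr_pdivrMr; lra.
have := h (a / (a + b + b)); rewrite t0 t1 => /(_ isT).
rewrite mulrAC ler_pdivlMr; last lra.
by nra.
Qed.

Lemma argmaxP (R : realType) (T : zmodType) (S : set T) (f : T -> R) :
  (exists x, is_maximizer S f x) -> is_maximizer S f (argmax S f).
Proof. exact: xgetPex. Qed.

Section Dot.
Context {R : realType} {n : nat}.
Implicit Types x y z : 'cV[R]_n.

Lemma dotvC x y : dotv x y = dotv y x.
Proof. by apply: eq_bigr => j _; rewrite mulrC. Qed.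

Lemma dotvDl x y z : dotv (x + y) z = dotv x z + dotv y z.
Proof. by rewrite /dotv -big_split; apply: eq_bigr => j _; rewrite mxE mulrDl. Qed.

Lemma dotvZl a x y : dotv (a *: x) y = a * dotv x y.
Proof. by rewrite /dotv big_distrr /=; apply: eq_bigr => j _; rewrite mxE mulrA. Qed.

Lemma dotvNl x y : dotv (- x) y = - dotv x y.
Proof. by rewrite -scaleN1r dotvZl mulN1r. Qed.

Lemma dotvBl x y z : dotv (x - y) z = dotv x z - dotv y z.
Proof. by rewrite dotvDl dotvNl. Qed.

Lemma dotv0l x : dotv 0 x = 0.
Proof. by rewrite -(scale0r 0) dotvZl mul0r. Qed.

Lemma dotvBr x y z : dotv z (x - y) = dotv z x - dotv z y.
Proof. by rewrite dotvC dotvBl !(dotvC z). Qed.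

Lemma dotvZr a x y : dotv x (a *: y) = a * dotv x y.
Proof. by rewrite dotvC dotvZl dotvC. Qed.

Lemma dotv_suml I (s : seq I) (F : I -> 'cV[R]_n) x :
  dotv (\sum_(i <- s) F i) x = \sum_(i <- s) dotv (F i) x.
Proof.
by elim/big_rec2: _ => [|i a b _ <-]; rewrite ?dotv0l ?dotvDl.
Qed.

Lemma dotv_ge0 x : 0 <= dotv x x.
Proof. by apply: sumr_ge0 => j _; rewrite -expr2 sqr_ge0. Qed.

Lemma dotv_nonneg_ge0 x y : nonnegv x -> nonnegv y -> 0 <= dotv x y.
Proof. by move=> x0 y0; apply: sumr_ge0 => j _; rewrite mulr_ge0// ?x0 ?y0. Qed.

Lemma dotv_mulmx m (A : 'M[R]_(n, m)) x (y : 'cV[R]_m) :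
  dotv x (A *m y) = \sum_(i < m) dotv x (col i A) * y i 0.
Proof.
rewrite /dotv; under eq_bigr => j _ do rewrite mxE big_distrr /=.
rewrite exchange_big; apply: eq_bigr => i _; rewrite big_distrl /=.
by apply: eq_bigr => j _; rewrite mxE mulrA.
Qed.

Lemma nonneg_box B x : box B x -> nonnegv x.
Proof. by move=> bx j; have /andP[] := bx j. Qed.

(** The box is convex; [x + t (y - x)] is the form in which segments occur
    when a direction is tested. *)
Lemma box_segment B x y t : box B x -> box B y -> 0 <= t <= 1 ->
  box B (x + t *: (y - x)).
Proof.
move=> bx by_ /andP[t0 t1] j; rewrite !mxE.
have /andP[x0 x1] := bx j; have /andP[y0 y1] := by_ j.
by apply/andP; split; nra.
Qed.

Lemma orth_proj_boxP (B : R) x : 0 <= B ->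
  box B (orth_proj (box B) x) /\
  forall y, box B y ->
    dotv (x - orth_proj (box B) x) (x - orth_proj (box B) x)
    <= dotv (x - y) (x - y).
Proof.
move=> B0; have [] : is_maximizer (box B) (fun y => - enorm (x - y))
    (orth_proj (box B) x).
  apply: argmaxP; exists (\col_j Num.max 0 (Num.min B (x j 0))); split.
    by move=> j; rewrite mxE le_max lexx ge_max B0 ge_min lexx.
  move=> y by_; rewrite lerN2 ler_sqrt ?dotv_ge0//; apply: ler_sum => j _.
  rewrite !mxE -!expr2; have /andP[y0 y1] := by_ j.
  have [xB|xB] := leP B (x j 0).
    by rewrite (max_idPr B0) ler_sqr ?nnegrE; lra.
  have [x0|x0] := leP 0 (x j 0); first by rewrite subrr expr0n sqr_ge0.
  by nra.
by move=> bp mp; split=> // y /mp; rewrite lerN2 ler_sqrt ?dotv_ge0.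
Qed.

(** Moving the closest point [p] towards [y] cannot bring it closer to [x],
    which to first order says that the angle at [p] between [x] and [y] is
    obtuse. *)
Lemma orth_proj_obtuse (B : R) x y : 0 <= B -> box B y ->
  dotv (x - orth_proj (box B) x) (y - orth_proj (box B) x) <= 0.
Proof.
move=> B0 by_; have [bp mp] := orth_proj_boxP B x B0.
set p := orth_proj (box B) x in bp mp *.
suff : 2 * dotv (x - p) (y - p) <= 0 by lra.
apply: (@le0_of_le_small _ _ (dotv (y - p) (y - p))) => t /andP[t0 t1].
have /mp : box B (p + t *: (y - p)) by apply: box_segment; rewrite ?(ltW t0) ?ltW.
rewrite opprD addrA.
move: (x - p) (y - p) => v w.
rewrite !(dotvBl, dotvBr, dotvZl, dotvZr) (dotvC w v) => h.
have h0 : 0 <= t * (t * dotv w w - 2 * dotv v w) by lra.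
by move: h0; rewrite pmulr_rge0//; lra.
Qed.

Lemma orth_proj_nonexpansive (B : R) x y : 0 <= B -> box B y ->
  dotv (orth_proj (box B) x - y) (orth_proj (box B) x - y)
  <= dotv (x - y) (x - y).
Proof.
move=> B0 by_; have := orth_proj_obtuse B x y B0 by_.
set p := orth_proj (box B) x.
have -> : x - y = (x - p) - (y - p) by rewrite opprB addrA subrK.
have -> : p - y = - (y - p) by rewrite opprB.
move: (x - p) (y - p) => v w; have := dotv_ge0 v.
rewrite !(dotvBl, dotvBr, dotvNl) (dotvC w (- w)) dotvNl (dotvC w v).
by lra.
Qed.

End Dot.

(** * Best response of one user *)

(** A reaction depends on the multipliers only through the price of the route:
    [reaction A u i lam] is convertible to
    [best_response (u i) (dotv lam (col i A))]. *)
Definition best_response {R : realType} (u : R -> R) (p : R) : R :=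
  argmax [set y : R | 0 <= y] (fun y => u y - p * y).

Section BestResponse.
Context {R : realType}.
Variables (u : R -> R) (B c eps : R).
Hypotheses (B0 : 0 < B) (c0 : 0 < c) (eps0 : 0 < eps).
Hypothesis uC2 : C2_on [set y : R | - eps < y] u.
Hypothesis du0 : u^`()%classic 0 <= B.
Hypothesis d2u : forall y : R, 0 <= y -> c <= - u^`(2)%classic y.

Lemma utility_derivable (y : R) : 0 <= y -> derivable u y 1.
Proof. by move=> y0; have /(uC2 y)[] : - eps < y by have := eps0; lra. Qed.

Lemma utility_deriv_drop (x y : R) : 0 <= x -> x <= y ->
  u^`()%classic y - u^`()%classic x <= - c * (y - x).
Proof.
move=> x0; rewrite le_eqVlt => /predU1P[->|xy]; first by rewrite !subrr mulr0.
have du (z : R) : x <= z -> derivable u^`()%classic z 1.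
  by move=> xz; have /(uC2 z)[] : - eps < z by have := eps0; lra.
have [z| |z] := @MVT R u^`()%classic u^`(2)%classic x y xy.
- rewrite in_itv/= => /andP[xz _].
  by apply: DeriveDef; [exact: du (ltW xz)|rewrite -derive1E].
- apply: derivable_within_continuous => z; rewrite in_itv/= => /andP[xz _].
  exact: du.
- rewrite in_itv => /andP[xz _] ->; apply: ler_wpM2r; first by lra.
  have /(d2u z) : 0 <= z by move: xz; rewrite /=; lra.
  by lra.
Qed.

(** Subtracting the quadratic leaves a function whose derivative points
    towards [x] from both sides. *)
Lemma utility_tangent (x y : R) : 0 <= x -> 0 <= y ->
  u y <= u x + u^`()%classic x * (y - x) - c / 2 * (y - x) ^+ 2.
Proof.
move=> x0 y0.
pose h (z : R) := u z - u^`()%classic x * z + c / 2 * (z - x) ^+ 2.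
pose dh (z : R) := u^`()%classic z - u^`()%classic x + c * (z - x).
have hd (z : R) : 0 <= z -> is_derive z 1 h (dh z).
  move=> z0; have uz := utility_derivable z z0.
  have := derivableP uz; rewrite -derive1E => duz.
  by apply: is_derive_eq; rewrite /dh /GRing.scale/=; field.
have hc (a b : R) : 0 <= a -> {within `[a, b], continuous h}.
  move=> a0; apply: derivable_within_continuous => z; rewrite in_itv/= => /andP[az _].
  by have [] := hd z (le_trans a0 az).
suff : h y <= h x by rewrite /h; lra.
have [xy|yx|->//] := ltgtP x y.
- have [z| |z] := @MVT R h dh x y xy.
  + by rewrite in_itv/= => /andP[xz _]; apply: hd; lra.
  + exact: hc.
  + rewrite in_itv/= => /andP[xz _] e.
    by have := utility_deriv_drop x z x0 (ltW xz); rewrite /dh in e; nra.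
- have [z| |z] := @MVT R h dh y x yx.
  + by rewrite in_itv/= => /andP[xz _]; apply: hd; lra.
  + exact: hc.
  + rewrite in_itv/= => /andP[yz zx] e.
    have z0 : 0 <= z by lra.
    by have := utility_deriv_drop z x z0 (ltW zx); rewrite /dh in e; nra.
Qed.

Lemma utility_deriv_le (x : R) : 0 <= x -> u^`()%classic x <= B.
Proof.
move=> x0; have := utility_deriv_drop 0 x (lexx 0) x0.
have : 0 <= c * x by rewrite mulr_ge0// ltW.
by have := du0; lra.
Qed.

Lemma best_response_maximizer (p : R) : 0 <= p ->
  is_maximizer [set y : R | 0 <= y] (fun y => u y - p * y) (best_response u p).
Proof.
move=> p0; apply: argmaxP.
(* Beyond this point the quadratic term outweighs the initial slope, and the
   payoff is below its value at 0. *)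
pose M : R := 2 * B / c.
have M0 : 0 <= M by rewrite divr_ge0 ?mulr_ge0// ltW.
have [x|x] := @EVT_max R (fun y => u y - p * y) 0 M M0.
  apply: derivable_within_continuous => z; rewrite in_itv/= => /andP[z0 _].
  have := utility_derivable z z0; move=> ?; apply: derivableB => //.
rewrite in_itv/= => /andP[x0 xM] mx; exists x; split=> //= y y0.
have [yM|/ltW My] := leP y M; first by apply: mx; rewrite in_itv/= y0.
have h0 := mx 0; rewrite in_itv/= lexx M0 in h0.
apply: le_trans (h0 isT); have := utility_tangent 0 y (lexx 0) y0.
have : B <= c / 2 * y.
  by move: My; rewrite /M ler_pdivrMr//; lra.
by have := du0; rewrite subr0; nra.
Qed.

Lemma best_response_ge0 (p : R) : 0 <= p -> 0 <= best_response u p.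
Proof. by move=> /best_response_maximizer[]. Qed.

(** Strong concavity: evaluate the tangent inequality at a point of the segment
    from the maximizer to [y], and let that point tend to the maximizer. *)
Lemma best_response_strong (p y : R) : 0 <= p -> 0 <= y ->
  u y - p * y + c / 2 * (y - best_response u p) ^+ 2
  <= u (best_response u p) - p * best_response u p.
Proof.
move=> p0 y0; have [/= x0 mx] := best_response_maximizer p p0.
set x := best_response u p in x0 mx *.
rewrite -subr_le0.
apply: (@le0_of_le_small _ _ (c / 2 * (y - x) ^+ 2)) => t /andP[t0 t1].
pose z := x + t * (y - x).
have z0 : 0 <= z by rewrite /z; nra.
have := mx z z0; have := utility_tangent z y z0 y0.
have := utility_tangent z x z0 x0.
have -> : y - z = (1 - t) * (y - x) by rewrite /z; ring.
have -> : x - z = - t * (y - x) by rewrite /z; ring.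
have -> : p * z = p * x + t * (p * (y - x)) by rewrite /z; ring.
set d := y - x; set g := u^`()%classic z.
have -> : p * y = p * x + p * d by rewrite /d; ring.
rewrite !exprMn => h1 h2 h3.
(* t * h2 + (1 - t) * h1 cancels the unknown slope g. *)
have {h1} : 0 <= (1 - t) * (u z + g * (- t * d) - c / 2 * ((- t) ^+ 2 * d ^+ 2) - u x).
  by rewrite mulr_ge0; lra.
have {h2} : 0 <= t * (u z + g * ((1 - t) * d) - c / 2 * ((1 - t) ^+ 2 * d ^+ 2) - u y).
  by rewrite mulr_ge0; lra.
move=> h2 h1.
have : 0 <= t * (u x - p * x - (u y - p * x - p * d) - c / 2 * (1 - t) * d ^+ 2).
  by lra.
by rewrite pmulr_rge0//; lra.
Qed.

(** Strong optimality against [y = 0], combined with the tangent at [0]. Both the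
    bound on demand and its vanishing at prices above [B] follow. *)
Lemma best_response_curb (p : R) : 0 <= p ->
  c * best_response u p ^+ 2 <= (B - p) * best_response u p.
Proof.
move=> p0; have x0 := best_response_ge0 p p0.
have := best_response_strong p 0 p0 (lexx 0).
have := utility_tangent 0 _ (lexx 0) x0.
by have := du0; rewrite sub0r subr0 sqrrN mulr0; nra.
Qed.

Lemma best_response_le (p : R) : 0 <= p -> best_response u p <= B / c.
Proof.
move=> p0; have x0 := best_response_ge0 p p0.
have := best_response_curb p p0.
rewrite ler_pdivlMr//; move: x0; rewrite le_eqVlt => /predU1P[<- _|x0 h].
  by rewrite mul0r ltW.
by rewrite -(ler_pM2r x0); nra.
Qed.

Lemma best_response_eq0 (p : R) : B <= p -> best_response u p = 0.
Proof.
move=> Bp; have p0 : 0 <= p by rewrite (le_trans (ltW B0)).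
have := best_response_ge0 p p0; have := best_response_curb p p0.
set x := best_response u p => h x0.
have : c * x ^+ 2 <= 0 by nra.
rewrite pmulr_rle0// => xx.
by apply/eqP; rewrite -sqrf_eq0 eq_le xx sqr_ge0.
Qed.

(** Adding the strong optimality of each of the two responses against the
    other, only the price difference survives. *)
Lemma best_response_monotone (p q : R) : 0 <= p -> 0 <= q ->
  c * (best_response u p - best_response u q) ^+ 2
  <= (q - p) * (best_response u p - best_response u q).
Proof.
move=> p0 q0; have x0 := best_response_ge0 p p0; have y0 := best_response_ge0 q q0.
have := best_response_strong p _ p0 y0; have := best_response_strong q _ q0 x0.
by lra.
Qed.

Lemma best_response_lipschitz (p q r : R) : 0 <= p -> 0 <= q ->
  c * ((best_response u p - best_response u q) * r) <= `|q - p| * `|r|.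
Proof.
move=> p0 q0; have := best_response_monotone p q p0 q0.
set d := best_response u p - best_response u q => h.
apply: le_trans (ler_norm _) _; rewrite !normrM mulrA ler_wpM2r//.
rewrite (gtr0_norm c0).
have : (q - p) * d <= `|q - p| * `|d| by rewrite -normrM ler_norm.
rewrite -[d ^+ 2]real_normK ?num_real// in h.
have := normr_ge0 d; rewrite le_eqVlt => /predU1P[<-|d0].
  by rewrite !mulr0 => _; exact: normr_ge0.
by move=> h'; rewrite -(ler_pM2r d0); lra.
Qed.

(** Deviating upwards gains at most the maximal marginal utility [B]; deviating
    downwards gains nothing, since it would save payments as well. *)
Lemma best_response_utility_loss (p y : R) : 0 <= p -> 0 <= y ->
  u y - u (best_response u p) <= B * `|y - best_response u p|.
Proof.
move=> p0 y0; have [/= x0 /(_ y y0)] := best_response_maximizer p p0.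
set x := best_response u p in x0 *.
have := utility_tangent x y x0 y0; have := utility_deriv_le x x0.
have [xy|yx] := ger0P (y - x).
  move=> xB tan _; have : 0 <= c * (y - x) ^+ 2 by rewrite mulr_ge0 ?sqr_ge0// ltW.
  by nra.
have xy : 0 <= x - y by lra.
move=> _ _ /= opt.
by have := mulr_ge0 p0 xy; have := mulr_ge0 (ltW B0) xy; lra.
Qed.

End BestResponse.

(** * The dual problem *)

(** The Lagrangian dual function; the reactions attain the maximum of the
    Lagrangian over nonnegative rates. *)
Definition dual {R : realType} {m N : nat} (A : 'M[R]_(m, N)) (b : 'cV[R]_m)
    (u : 'I_N -> R -> R) (lam : 'cV[R]_m) : R :=
  \sum_(i < N) (u i (reaction A u i lam) - dotv lam (col i A) * reaction A u i lam)
  + dotv lam b.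

(** The unused capacities, which form the gradient of [dual]. *)
Definition dual_grad {R : realType} {m N : nat} (A : 'M[R]_(m, N))
    (b : 'cV[R]_m) (u : 'I_N -> R -> R) (lam : 'cV[R]_m) : 'cV[R]_m :=
  b - A *m reactions A u lam.

Lemma dotv_dual_grad {R : realType} {m N : nat} (A : 'M[R]_(m, N)) (b : 'cV[R]_m)
    (u : 'I_N -> R -> R) (v lam : 'cV[R]_m) :
  dotv v (dual_grad A b u lam)
  = dotv v b - \sum_(i < N) dotv v (col i A) * reaction A u i lam.
Proof.
rewrite /dual_grad dotvBr dotv_mulmx; congr (_ - _).
by apply: eq_bigr => i _; rewrite mxE.
Qed.

Lemma continuous_sumr {R : realType} {T : topologicalType} {I : Type}
    (s : seq I) (F : I -> T -> R) : (forall i, continuous (F i)) ->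
  continuous (fun x => \sum_(i <- s) F i x).
Proof.
move=> cF; apply: (@continuous_big R I +%R 0 xpredT) => [[y z]|i _]; last exact: cF.
by apply: cvgD; [exact: cvg_fst|exact: cvg_snd].
Qed.

Section Dual.
Context {R : realType} {m N : nat}.
Variables (A : 'M[R]_(m, N)) (b : 'cV[R]_m) (u : 'I_N -> R -> R) (B c eps : R).
Hypothesis A01 : forall j i, A j i = 0 \/ A j i = 1.
Hypothesis b0 : forall j, 0 < b j 0.
Hypotheses (B0 : 0 < B) (c0 : 0 < c) (eps0 : 0 < eps).
Hypothesis uC2 : forall i, C2_on [set y : R | - eps < y] (u i).
Hypothesis du0 : forall i, (u i)^`() 0 <= B.
Hypothesis d2u : forall i (y : R), 0 <= y -> c <= - (u i)^`(2)%classic y.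

Local Notation x := (reaction A u).
Local Notation price lam i := (dotv lam (col i A)).
Local Notation d := (dual A b u).
Local Notation g := (dual_grad A b u).

Lemma routing_ge0 j i : 0 <= A j i.
Proof. by have [->|->] := A01 j i. Qed.

Lemma price_ge0 lam i : nonnegv lam -> 0 <= price lam i.
Proof.
move=> lam0; apply: dotv_nonneg_ge0 => // j; rewrite mxE; exact: routing_ge0.
Qed.

Lemma reaction_ge0 lam i : nonnegv lam -> 0 <= x i lam.
Proof.
move=> lam0; apply: (best_response_ge0 (u i) B c eps _ _ _ (uC2 i) (du0 i) (d2u i)) => //.
exact: price_ge0.
Qed.

Lemma reaction_strong lam i (y : R) : nonnegv lam -> 0 <= y ->
  u i y - price lam i * y + c / 2 * (y - x i lam) ^+ 2
  <= u i (x i lam) - price lam i * x i lam.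
Proof.
move=> lam0 y0.
apply: (best_response_strong (u i) B c eps _ _ _ (uC2 i) (du0 i) (d2u i)) => //.
exact: price_ge0.
Qed.

(** The reactions to [lam] are admissible for the maximization that defines
    the dual function at any other [mu]. *)
Lemma dual_subgradient lam mu : nonnegv lam -> nonnegv mu ->
  d lam + dotv (mu - lam) (g lam) <= d mu.
Proof.
move=> lam0 mu0; rewrite dotv_dual_grad dotvBl /dual.
have : \sum_(i < N) (u i (x i lam) - price lam i * x i lam)
       - \sum_(i < N) price (mu - lam) i * x i lam
       <= \sum_(i < N) (u i (x i mu) - price mu i * x i mu).
  rewrite -sumrB; apply: ler_sum => i _; rewrite dotvBl.
  have := reaction_strong mu i (x i lam) mu0 (reaction_ge0 lam i lam0).
  have : 0 <= c / 2 * (x i lam - x i mu) ^+ 2.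
    by rewrite mulr_ge0 ?sqr_ge0// divr_ge0// ltW.
  by lra.
by lra.
Qed.

(** Demand is Lipschitz in prices, so the gradient of the dual function is
    Lipschitz too: this is the bound along one direction [v]. *)
Lemma dual_grad_lipschitz lam (v : 'cV[R]_m) (t : R) : nonnegv lam ->
  nonnegv (lam + t *: v) -> 0 <= t ->
  dotv v (g (lam + t *: v)) - dotv v (g lam)
  <= t * (c^-1 * \sum_(i < N) price v i ^+ 2).
Proof.
move=> lam0 mu0 t0; rewrite !dotv_dual_grad.
rewrite opprB addrC addrA subrK -sumrB 2!big_distrr/=.
apply: ler_sum => i _; rewrite -mulrBr mulrC.
have p0 := price_ge0 _ i lam0; have q0 := price_ge0 _ i mu0.
have := best_response_lipschitz _ B c eps B0 c0 eps0 (uC2 i) (du0 i) (d2u i) _ _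
  (price v i) p0 q0.
have -> : price (lam + t *: v) i - price lam i = t * price v i.
  by rewrite dotvDl dotvZl addrC addKr.
rewrite normrM (ger0_norm t0).
rewrite -mulrA -expr2 real_normK ?num_real// => h.
by rewrite -(ler_pM2l c0) [c * (t * _)]mulrCA mulVKf ?gt_eqF ?h.
Qed.

Lemma dual_smooth lam mu : nonnegv lam -> nonnegv mu ->
  d mu <= d lam + dotv (mu - lam) (g lam)
          + c^-1 * \sum_(i < N) price (mu - lam) i ^+ 2.
Proof.
move=> lam0 mu0; have := dual_subgradient mu lam mu0 lam0.
have := dual_grad_lipschitz lam (mu - lam) 1 lam0.
rewrite scale1r [lam + _]addrC subrK => /(_ mu0 ler01).
rewrite mul1r -(opprB mu lam) [dotv (- _) _]dotvNl.
by lra.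
Qed.

Lemma dotv_continuous (v : 'cV[R]_m) :
  continuous (fun mu : 'rV[R]_m => dotv mu^T v).
Proof.
have -> : (fun mu : 'rV[R]_m => dotv mu^T v) = fun mu => \sum_j mu 0 j * v j 0.
  by apply/funext => mu; apply: eq_bigr => j _; rewrite mxE.
apply: continuous_sumr => j mu.
apply: (@continuousM R _ (fun mu : 'rV[R]_m => mu 0 j) (cst (v j 0))).
  exact: coord_continuous.
exact: cst_continuous.
Qed.

(** The subgradient and the smoothness inequality squeeze the dual function
    between two polynomials that agree at [lam]. *)
Lemma dual_continuous :
  {within [set mu : 'rV[R]_m | box B mu^T], continuous (fun mu : 'rV[R]_m => d mu^T)}.
Proof.
apply/subspace_continuousP => lam blam.
pose lo (mu : 'rV[R]_m) := d lam^T + (dotv mu^T (g lam^T) - dotv lam^T (g lam^T)).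
pose hi (mu : 'rV[R]_m) :=
  lo mu + c^-1 * \sum_(i < N) (price mu^T i - price lam^T i) ^+ 2.
have dotvBc v : continuous (fun mu : 'rV[R]_m => dotv mu^T v - dotv lam^T v).
  move=> mu; apply: (@continuousB _ _ _ (fun mu : 'rV[R]_m => dotv mu^T v) (cst _)).
    exact: dotv_continuous.
  exact: cst_continuous.
have lo_continuous : continuous lo.
  move=> mu; apply: (@continuousD _ _ _ (cst (d lam^T)) (fun mu : 'rV[R]_m =>
    dotv mu^T (g lam^T) - dotv lam^T (g lam^T))); last exact: dotvBc.
  exact: cst_continuous.
have hi_continuous : continuous hi.
  move=> mu; apply: (@continuousD _ _ _ lo (fun mu : 'rV[R]_m =>
    c^-1 * \sum_(i < N) (price mu^T i - price lam^T i) ^+ 2)).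
    exact: lo_continuous.
  apply: (@continuousM _ _ (cst c^-1) (fun mu : 'rV[R]_m =>
    \sum_(i < N) (price mu^T i - price lam^T i) ^+ 2)); first exact: cst_continuous.
  apply: continuous_sumr => i nu.
  by apply: (@continuousM _ _ (fun nu : 'rV[R]_m => price nu^T i - price lam^T i)
    (fun nu : 'rV[R]_m => price nu^T i - price lam^T i)); exact: dotvBc.
have lo_cvg : lo mu @[mu --> lam] --> d lam^T.
  have <- : lo lam = d lam^T by rewrite /lo subrr addr0.
  exact: lo_continuous.
have hi_cvg : hi mu @[mu --> lam] --> d lam^T.
  have <- : hi lam = d lam^T.
    rewrite /hi /lo subrr addr0 big1 ?mulr0 ?addr0// => i _.
    by rewrite subrr expr0n.
  exact: hi_continuous.
apply: (@squeeze_cvgr _ _ _ _ lo hi).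
- rewrite near_withinE; apply: nearW => mu bmu.
  have l0 := nonneg_box _ _ blam; have m0 := nonneg_box _ _ bmu.
  apply/andP; split; first by rewrite /lo -dotvBl; exact: dual_subgradient.
  apply: le_trans (dual_smooth _ _ l0 m0) _; rewrite /hi /lo -dotvBl lerD2l.
  by under eq_bigr do rewrite dotvBl.
- by apply: cvg_within_filter; exact: lo_cvg.
- by apply: cvg_within_filter; exact: hi_cvg.
Qed.

Lemma dual_minimizer_exists : exists2 lam, box B lam &
  forall mu, box B mu -> d lam <= d mu.
Proof.
pose S := [set mu : 'rV[R]_m | box B mu^T].
have [|||lam] := @EVT_min_rV R m (fun mu => d mu^T) S.
- by exists 0 => j; rewrite !mxE lexx ltW.
- rewrite (_ : S = [set v : 'rV[R]_m | forall j, `[0, B]%classic (v ord0 j)]).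
    by apply: (@rV_compact R m (fun=> `[0, B]%classic)) => j; exact: segment_compact.
  apply/seteqP; split=> mu /= bmu j.
    by have := bmu j; rewrite mxE in_itv.
  by have := bmu j; rewrite in_itv/= mxE.
- exact: dual_continuous.
- rewrite inE => blam mlam; exists lam^T => // mu bmu.
  by have := mlam mu^T; rewrite trmxK; apply; rewrite inE /S/= trmxK.
Qed.

Section Optimum.
Variable opt : 'cV[R]_m.
Hypothesis bopt : box B opt.
Hypothesis mopt : forall mu, box B mu -> d opt <= d mu.

Let opt0 : nonnegv opt := nonneg_box _ _ bopt.

(** Convexity gives the inequality with the gradient taken at a point of the
    segment from [opt] to [mu]; by Lipschitz continuity that point may tend to
    [opt]. *)
Lemma dual_opt_variational mu : box B mu -> 0 <= dotv (mu - opt) (g opt).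
Proof.
move=> bmu; rewrite -oppr_le0.
apply: (@le0_of_le_small _ _ (c^-1 * \sum_(i < N) price (mu - opt) i ^+ 2)) => t.
move=> /andP[t0 t1]; pose z := opt + t *: (mu - opt).
have bz : box B z by apply: box_segment => //; rewrite !ltW.
have z0 := nonneg_box _ _ bz.
have := dual_grad_lipschitz opt (mu - opt) t opt0 z0 (ltW t0); rewrite -/z.
have := dual_subgradient z opt z0 opt0; have := mopt z bz.
have -> : opt - z = - t *: (mu - opt) by rewrite /z opprD addrA subrr add0r scaleNr.
rewrite dotvZl => h1 h2.
have : 0 <= t * dotv (mu - opt) (g z) by lra.
by rewrite pmulr_rge0//; lra.
Qed.

(** Test the variational inequality by raising one component of [opt] to [B].
    This says nothing if that component already is [B]; but then the link is
    so expensive that nobody uses it. *)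
Lemma dual_opt_feasible j : 0 <= g opt j 0.
Proof.
have /andP[ge0 leB] := bopt j.
have [ltB|Ble] := ltP (opt j 0) B.
  pose mu : 'cV[R]_m := \col_k if k == j then B else opt k 0.
  have /dual_opt_variational : box B mu.
    by move=> k; rewrite mxE; case: eqP => // _; rewrite lexx ltW.
  rewrite /dotv (bigD1 j)//= big1 ?addr0; last first.
    by move=> k /negPf kj; rewrite !mxE kj subrr mul0r.
  by rewrite !mxE eqxx pmulr_rge0 ?subr_gt0.
rewrite /dual_grad !mxE big1 ?subr0; first exact: ltW.
move=> i _; rewrite mxE; have [->|Aji] := A01 j i; first by rewrite mul0r.
suff -> : x i opt = 0 by rewrite mulr0.
apply: (best_response_eq0 (u i) B c eps _ _ _ (uC2 i) (du0 i) (d2u i)) => //.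
apply: le_trans Ble _.
rewrite /dotv (bigD1 j)//= mxE Aji mulr1 lerDl; apply: sumr_ge0 => k _.
by rewrite mxE mulr_ge0 ?routing_ge0.
Qed.

(** Nonnegative because both vectors are; nonpositive by the variational
    inequality at [0], which lies in the box. *)
Lemma dual_opt_complementary : dotv opt (g opt) = 0.
Proof.
apply/eqP; rewrite eq_le dotv_nonneg_ge0 ?andbT//; last exact: dual_opt_feasible.
have /dual_opt_variational : box B (0 : 'cV[R]_m) by move=> j; rewrite mxE lexx ltW.
by rewrite sub0r dotvNl oppr_ge0.
Qed.

Lemma strong_duality : d opt = total_utility u (reactions A u opt).
Proof.
have := dual_opt_complementary; rewrite dotv_dual_grad /dual /total_utility sumrB.
by under [X in _ -> _ = X]eq_bigr do rewrite mxE; lra.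
Qed.

(** Weak duality, with the strong concavity of the utilities quantifying the
    distance of [y] from the reactions to [lam]. *)
Lemma weak_duality_gap lam y : nonnegv lam -> feasible A b y ->
  total_utility u y + c / 2 * \sum_(i < N) (y i 0 - x i lam) ^+ 2 <= d lam.
Proof.
move=> lam0 [y0 yb].
have : 0 <= dotv lam (b - A *m y).
  by apply: dotv_nonneg_ge0 => // j; have := yb j; rewrite !mxE subr_ge0.
rewrite dotvBr dotv_mulmx /total_utility /dual big_distrr/= -big_split/=.
have : \sum_(i < N) (u i (y i 0) + c / 2 * (y i 0 - x i lam) ^+ 2)
   - \sum_(i < N) price lam i * y i 0
   <= \sum_(i < N) (u i (x i lam) - price lam i * x i lam).
  rewrite -sumrB; apply: ler_sum => i _.
  by have := reaction_strong lam i (y i 0) lam0 (y0 i); lra.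
by lra.
Qed.

Lemma reactions_opt_feasible : feasible A b (reactions A u opt).
Proof.
split=> j; first by rewrite mxE; exact: reaction_ge0.
by have := dual_opt_feasible j; rewrite /dual_grad !mxE subr_ge0.
Qed.

(** [primal_opt] is some maximizer, and all maximizers have the same utility. *)
Lemma primal_opt_utility :
  total_utility u (primal_opt A b u) = total_utility u (reactions A u opt).
Proof.
have weak y : feasible A b y ->
    total_utility u y <= total_utility u (reactions A u opt).
  move=> fy; have := weak_duality_gap opt y opt0 fy; rewrite strong_duality.
  have : 0 <= c / 2 * \sum_(i < N) (y i 0 - x i opt) ^+ 2.
    rewrite mulr_ge0 ?divr_ge0 ?(ltW c0)//.
    by apply: sumr_ge0 => i _; exact: sqr_ge0.
  by lra.
have [] : is_maximizer (feasible A b) (total_utility u) (primal_opt A b u).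
  by apply: argmaxP; exists (reactions A u opt); split=> //;
    exact: reactions_opt_feasible.
move=> fp mp; apply/eqP; rewrite eq_le weak//=.
exact/mp/reactions_opt_feasible.
Qed.

(** The gap in weak duality, taken at the primal optimum, where its utility is
    replaced by the dual optimum. *)
Lemma reactions_error lam : nonnegv lam ->
  c / 2 * \sum_(i < N) (x i opt - x i lam) ^+ 2 <= d lam - d opt.
Proof.
move=> lam0; have := weak_duality_gap lam _ lam0 reactions_opt_feasible.
rewrite -strong_duality.
by under eq_bigr do rewrite mxE; lra.
Qed.

(** The optimal load respects the capacity, and each routing entry is at most
    [1]. *)
Lemma link_overload lam j :
  \sum_(i < N) A j i * x i lam - b j 0 <= \sum_(i < N) `|x i opt - x i lam|.
Proof.
have : 0 <= b j 0 - \sum_(i < N) A j i * x i opt.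
  have := dual_opt_feasible j; rewrite /dual_grad !mxE.
  by under eq_bigr do rewrite mxE.
have : \sum_(i < N) A j i * x i lam - \sum_(i < N) A j i * x i opt
   <= \sum_(i < N) `|x i opt - x i lam|.
  rewrite -sumrB; apply: ler_sum => i _; rewrite -mulrBr distrC.
  by have [->|->] := A01 j i; rewrite ?mul0r// mul1r ler_norm.
by lra.
Qed.

Lemma utility_shortfall lam : nonnegv lam ->
  total_utility u (primal_opt A b u) - total_utility u (reactions A u lam)
  <= B * \sum_(i < N) `|x i opt - x i lam|.
Proof.
move=> lam0; rewrite primal_opt_utility /total_utility -sumrB big_distrr/=.
apply: ler_sum => i _; rewrite !mxE.
apply: (best_response_utility_loss (u i) B c eps _ _ _ (uC2 i) (du0 i) (d2u i)) => //.
  exact: price_ge0.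
exact: reaction_ge0.
Qed.

End Optimum.

(** Jensen's inequality, obtained by summing the subgradient inequality at the
    average, whose linear terms cancel. *)
Lemma dual_average (s : seq 'cV[R]_m) (n : nat) : (0 < n)%N -> size s = n ->
  (forall l, l \in s -> nonnegv l) ->
  n%:R * d (n%:R^-1 *: \sum_(l <- s) l) <= \sum_(l <- s) d l.
Proof.
move=> n0 sn s0; set avg := _ *: _.
have nn : n%:R != 0 :> R by rewrite pnatr_eq0 -lt0n.
have avg0 : nonnegv avg.
  move=> j; rewrite mxE summxE mulr_ge0 ?invr_ge0//.
  by rewrite big_seq; apply: sumr_ge0 => l /s0.
have : \sum_(l <- s) (d avg + dotv (l - avg) (g avg)) <= \sum_(l <- s) d l.
  by rewrite 2!big_seq; apply: ler_sum => l /s0 l0; exact: dual_subgradient.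
rewrite big_split/= -dotv_suml sumrB !big_const_seq count_predT sn.
rewrite !iter_addr_0.
have -> : \sum_(l <- s) l = avg *+ n.
  by rewrite -scaler_nat scalerA divff// scale1r.
by rewrite subrr dotv0l addr0 mulr_natl.
Qed.

End Dual.

(** * Stochastic gradient descent along a history of draws *)

(** The newest draw is the head of the history, so that one more step of the
    method is one more [cons]. The step number is passed because the step size
    depends on it. *)
Fixpoint iterate {I V : Type} (step : nat -> V -> I -> V) (l1 : V) (s : seq I) : V :=
  if s is i :: s' then step (size s) (iterate step l1 s') i else l1.

(** The iterates that precede the last one, newest first. For a history of length
    [T] they are the [T] iterates that the method averages. *)
Fixpoint past_iterates {I V : Type} (step : nat -> V -> I -> V) (l1 : V)
    (s : seq I) : seq V :=
  if s is i :: s' then iterate step l1 s' :: past_iterates step l1 s' else [::].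

Lemma size_past_iterates {I V : Type} (step : nat -> V -> I -> V) l1 (s : seq I) :
  size (past_iterates step l1 s) = size s.
Proof. by elim: s => //= i s ->. Qed.

Lemma sum_tupleS {R : realType} (I : finType) (n : nat) (F : seq I -> R) :
  \sum_(s : n.+1.-tuple I) F s = \sum_(s : n.-tuple I) \sum_(i : I) F (i :: s).
Proof.
rewrite exchange_big pair_big/=.
rewrite (reindex (fun p : I * n.-tuple I => [tuple of p.1 :: p.2]))//.
exists (fun s : n.+1.-tuple I => (thead s, [tuple of behead s])).
  by move=> [i s] _ /=; congr pair; apply/val_inj.
by move=> s _; rewrite -tuple_eta.
Qed.

Definition stoch_grad {R : realType} {m N : nat} (A : 'M[R]_(m, N))
    (b : 'cV[R]_m) (u : 'I_N -> R -> R) (lam : 'cV[R]_m) (i : 'I_N) : 'cV[R]_m :=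
  b - (N%:R * reaction A u i lam) *: col i A.

Definition sgd_step {R : realType} {m N : nat} (A : 'M[R]_(m, N))
    (b : 'cV[R]_m) (u : 'I_N -> R -> R) (B K : R) (t : nat) (lam : 'cV[R]_m)
    (i : 'I_N) : 'cV[R]_m :=
  orth_proj (box B) (lam - (K / Num.sqrt t%:R) *: stoch_grad A b u lam i).

Lemma stoch_grad_unbiased {R : realType} {m N : nat} (A : 'M[R]_(m, N))
    (b : 'cV[R]_m) (u : 'I_N -> R -> R) (v lam : 'cV[R]_m) :
  \sum_(i < N) dotv v (stoch_grad A b u lam i) = N%:R * dotv v (dual_grad A b u lam).
Proof.
rewrite dotv_dual_grad mulrBr.
under eq_bigr do rewrite dotvBr dotvZr.
rewrite sumrB sumr_const card_ord -[dotv v b *+ N]mulr_natl; congr (_ - _).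
by rewrite big_distrr; apply: eq_bigr => i _; rewrite /= mulrAC mulrA.
Qed.

Section Descent.
Context {R : realType} {m N : nat}.
Variables (A : 'M[R]_(m, N)) (b : 'cV[R]_m) (u : 'I_N -> R -> R).
Variables (B sigma eps K : R) (opt l1 : 'cV[R]_m).
Hypothesis A01 : forall j i, A j i = 0 \/ A j i = 1.
Hypothesis b0 : forall j, 0 < b j 0.
Hypotheses (m0 : (0 < m)%N) (N0 : (0 < N)%N).
Hypotheses (B0 : 0 < B) (sigma0 : 0 < sigma) (eps0 : 0 < eps) (K0 : 0 < K).
Hypothesis uC2 : forall i, C2_on [set y : R | - eps < y] (u i).
Hypothesis du0 : forall i, (u i)^`() 0 <= B.
Hypothesis d2u : forall i (y : R), 0 <= y -> N%:R * sigma <= - (u i)^`(2)%classic y.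
Hypotheses (bopt : box B opt) (bl1 : box B l1).
Hypothesis mopt : forall mu, box B mu -> dual A b u opt <= dual A b u mu.

Local Notation d := (dual A b u).
Local Notation G := (stoch_grad A b u).
Local Notation step := (sgd_step A b u B K).
Local Notation sqdist lam := (dotv (lam - opt) (lam - opt)).
Local Notation gap lam := (d lam - d opt).

Let N0r : 0 < N%:R :> R. Proof. by rewrite ltr0n. Qed.
Let c0 : 0 < N%:R * sigma. Proof. by rewrite mulr_gt0. Qed.

(** The demand is at most [B / (N sigma)], so each component of the stochastic
    gradient lies between [b j - B / sigma] and [b j]. *)
Lemma stoch_grad_sq_le lam i : nonnegv lam ->
  dotv (G lam i) (G lam i) <= \sum_(j < m) Num.max (b j 0) (B / sigma - b j 0) ^+ 2.
Proof.
move=> lam0; apply: ler_sum => j _; rewrite -expr2 !mxE.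
have x0 := reaction_ge0 A u B (N%:R * sigma) eps A01 B0 c0 eps0 uC2 du0 d2u lam i lam0.
have p0 := price_ge0 A A01 lam i lam0.
have : reaction A u i lam <= B / (N%:R * sigma) :=
  best_response_le (u i) B _ eps B0 c0 eps0 (uC2 i) (du0 i) (d2u i) _ p0.
move: (reaction A u i lam) x0 => y y0.
rewrite ler_pdivlMr// => yB.
have {}yB : N%:R * y <= B / sigma by rewrite ler_pdivlMr// -mulrA mulrCA.
have Ny0 : 0 <= N%:R * y by rewrite mulr_ge0.
have M0 : 0 <= Num.max (b j 0) (B / sigma - b j 0) by rewrite le_max ltW.
rewrite -[X in X <= _]real_normK ?num_real// ler_sqr ?nnegrE//.
rewrite ler_norml le_max lerNl le_max; have bj := b0 j.
by have [->|->] := A01 j i; rewrite ?mulr0 ?mulr1; apply/andP; split; apply/orP;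
  ((left; lra) || (right; lra)).
Qed.

Local Notation L2 := (\sum_(j < m) Num.max (b j 0) (B / sigma - b j 0) ^+ 2).

Lemma sgd_step_box t lam i : box B (step t lam i).
Proof. by have [] := orth_proj_boxP B
  (lam - (K / Num.sqrt t%:R) *: G lam i) (ltW B0). Qed.

(** Expanding the square, the cross term averages to the true gradient, which
    the subgradient inequality turns into the dual gap. *)
Lemma sgd_expected_step t lam : box B lam ->
  \sum_(i < N) sqdist (step t lam i)
  <= N%:R * (sqdist lam - 2 * (K / Num.sqrt t%:R) * gap lam
             + (K / Num.sqrt t%:R) ^+ 2 * L2).
Proof.
set eta := K / _ => blam; have eta0 : 0 <= eta by rewrite divr_ge0 ?sqrtr_ge0// ltW.
have lam0 := nonneg_box _ _ blam; have opt0 := nonneg_box _ _ bopt.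
apply: (@le_trans _ _ (\sum_(i < N)
    (sqdist lam + eta ^+ 2 * L2 - 2 * eta * dotv (lam - opt) (G lam i)))).
  apply: ler_sum => i _.
  apply: le_trans (orth_proj_nonexpansive B _ opt (ltW B0) bopt) _.
  rewrite -/eta addrAC; have := stoch_grad_sq_le lam i lam0.
  move: (lam - opt) (G lam i) => v w.
  rewrite !(dotvBl, dotvBr, dotvZl, dotvZr) (dotvC w v) => h.
  have : eta ^+ 2 * dotv w w <= eta ^+ 2 * L2 by rewrite ler_wpM2l ?sqr_ge0.
  by lra.
rewrite sumrB sumr_const card_ord -big_distrr/= stoch_grad_unbiased -mulr_natl.
have : gap lam <= dotv (lam - opt) (dual_grad A b u lam).
  have := dual_subgradient A b u B _ eps A01 B0 c0 eps0 uC2 du0 d2u lam opt lam0 opt0.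
  by rewrite -(opprB lam opt) dotvNl; lra.
move=> /(ler_wpM2l eta0) /(ler_wpM2l (ltW N0r)); lra.
Qed.

Local Notation lam_ s := (iterate step l1 s).
Local Notation past s := (past_iterates step l1 s).

Lemma iterate_box s : box B (lam_ s).
Proof. by case: s => //= i s; exact: sgd_step_box. Qed.

Lemma past_iterates_box s l : l \in past s -> box B l.
Proof.
by elim: s => //= i s IH; rewrite inE => /predU1P[->|/IH//]; exact: iterate_box.
Qed.

Lemma sqdist_box lam : box B lam -> sqdist lam <= m%:R * B ^+ 2.
Proof.
move=> blam; rewrite mulr_natl -[m in X in _ <= X]card_ord -sumr_const.
apply: ler_sum => j _; rewrite !mxE -expr2.
have /andP[? ?] := blam j; have /andP[? ?] := bopt j.
by rewrite -subr_ge0 subr_sqr mulr_ge0; lra.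
Qed.

(** The step sizes are proportional to [1 / sqrt t]: this bounds their sum by a
    telescoping one. *)
Lemma sqrtr_succ (n : nat) :
  (Num.sqrt n.+1%:R)^-1 <= 2 * (Num.sqrt n.+1%:R - Num.sqrt n%:R) :> R.
Proof.
have s0 : 0 < Num.sqrt n.+1%:R :> R by rewrite sqrtr_gt0 ltr0n.
have r0 : 0 <= Num.sqrt n%:R :> R by rewrite sqrtr_ge0.
have : Num.sqrt n.+1%:R ^+ 2 = 1 + Num.sqrt n%:R ^+ 2 :> R.
  by rewrite !sqr_sqrtr ?ler0n// -natr1 addrC.
move: (Num.sqrt n.+1%:R) (Num.sqrt n%:R) s0 r0 => s r s0 r0 sr.
by rewrite -(ler_pM2l s0) mulfV ?gt_eqF//; nra.
Qed.

Local Notation pot s := (m%:R * B ^+ 2 - sqdist (lam_ s)).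

(** The potential [m B^2 - sqdist] is nonnegative, which allows its coefficient
    [sqrt t / (2 K) = 1 / (2 eta_t)] to be raised at each step; this replaces
    summation by parts. The step sizes themselves add up to at most
    [2 K sqrt n]. Expectations appear as sums over the [N ^ n] equally likely
    histories. *)
Lemma sgd_total_gap (n : nat) :
  \sum_(s : n.-tuple 'I_N) \sum_(l <- past s) gap l
  <= N%:R ^+ n * (K * L2 * Num.sqrt n%:R)
     + Num.sqrt n%:R / (2 * K) *
       \sum_(s : n.-tuple 'I_N) pot s.
Proof.
elim: n => [|n IH].
  rewrite sqrtr0 !mul0r !mulr0 addr0 big1// => s _.
  by rewrite tuple0 big_nil.
rewrite (sum_tupleS _ _ (fun s => \sum_(l <- past s) gap l)).
rewrite (sum_tupleS _ _ (fun s => pot s)) /=.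
set eta := K / Num.sqrt n.+1%:R.
set r := Num.sqrt n.+1%:R in eta *; set q := Num.sqrt n%:R in IH *.
have r0 : 0 < r by rewrite sqrtr_gt0 ltr0n.
have qr : q <= r by rewrite ler_wsqrtr// ler_nat.
have rq : r^-1 <= 2 * (r - q) by exact: sqrtr_succ.
have L0 : 0 <= L2 by apply: sumr_ge0 => j _; exact: sqr_ge0.
have pot0 s : 0 <= pot s by rewrite subr_ge0 sqdist_box//; exact: iterate_box.
have step_gap (s : n.-tuple 'I_N) : \sum_(i < N) \sum_(l <- past (i :: s)) gap l
    <= N%:R * (\sum_(l <- past s) gap l) + N%:R * (K * L2 * (r - q))
       + r / (2 * K) * \sum_(i < N) pot (i :: s) - q / (2 * K) * (N%:R * pot s).
  under eq_bigr do rewrite /= big_cons.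
  rewrite sumr_const card_ord -[_ *+ N]mulr_natl.
  have -> : \sum_(i < N) pot (i :: s)
      = N%:R * (m%:R * B ^+ 2) - \sum_(i < N) sqdist (step n.+1 (lam_ s) i).
    by rewrite sumrB sumr_const card_ord [N%:R * _]mulr_natl /= size_tuple.
  have := sgd_expected_step n.+1 (lam_ s) (iterate_box s); rewrite -/r -/eta.
  move: (\sum_(i < N) _) (gap (lam_ s)) (\sum_(l <- past s) gap l) => S g W h.
  have k1 : r / (2 * K) * S <= r / (2 * K) *
      (N%:R * (sqdist (lam_ s) - 2 * eta * g + eta ^+ 2 * L2)).
    by rewrite ler_wpM2l// divr_ge0 ?mulr_ge0// ltW.
  have k2 : q / (2 * K) * (N%:R * pot s) <= r / (2 * K) * (N%:R * pot s).
    rewrite ler_wpM2r ?mulr_ge0// ler_wpM2r// invr_ge0 mulr_ge0// ltW//.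
  have k3 : N%:R * K * L2 * r^-1 <= N%:R * K * L2 * (2 * (r - q)).
    by rewrite ler_wpM2l// !mulr_ge0// ltW.
  have e : r / (2 * K) * (N%:R * (sqdist (lam_ s) - 2 * eta * g + eta ^+ 2 * L2))
     = r / (2 * K) * (N%:R * sqdist (lam_ s)) - N%:R * g + N%:R * K * L2 * r^-1 / 2.
    by rewrite /eta; field; rewrite ?gt_eqF.
  rewrite {}e in k1.
  by lra.
apply: le_trans (ler_sum _ (fun s _ => step_gap s)) _.
rewrite sumrB !big_split/= sumr_const card_tuple card_ord -!big_distrr/=.
have := ler_wpM2l (ltW N0r) IH.
rewrite -[_ *+ (N ^ n)]mulr_natl natrX [N%:R ^+ n.+1]exprS.
by lra.
Qed.

Local Notation avg T s := (T%:R^-1 *: \sum_(l <- past s) l).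
Local Notation D := (m%:R * B ^+ 2 / (2 * K) + K * L2).

Lemma average_nonneg T s : nonnegv (avg T s).
Proof.
move=> j; rewrite mxE summxE mulr_ge0 ?invr_ge0// big_seq.
by apply: sumr_ge0 => l /past_iterates_box/nonneg_box.
Qed.

(** Jensen's inequality passes from the total gap to the gap of the average; the
    squared distance is dropped from the potential. *)
Lemma sgd_average_gap (T : nat) : (0 < T)%N ->
  \sum_(s : T.-tuple 'I_N) gap (avg T s) <= N%:R ^+ T * (D / Num.sqrt T%:R).
Proof.
move=> T0; set q := Num.sqrt T%:R.
have q0 : 0 < q by rewrite sqrtr_gt0 ltr0n.
have qq : q ^+ 2 = T%:R by rewrite sqr_sqrtr.
have jensen : \sum_(s : T.-tuple 'I_N) q ^+ 2 * gap (avg T s)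
    <= \sum_(s : T.-tuple 'I_N) \sum_(l <- past s) gap l.
  apply: ler_sum => s _; rewrite qq mulrBr sumrB big_const_seq count_predT.
  rewrite size_past_iterates size_tuple iter_addr_0 -[d opt *+ T]mulr_natl lerB//.
  apply: (dual_average A b u B _ eps A01 B0 c0 eps0 uC2 du0 d2u) => //.
    by rewrite size_past_iterates size_tuple.
  by move=> l /past_iterates_box/nonneg_box.
rewrite -big_distrr/= in jensen.
have := sgd_total_gap T; rewrite -/q.
have : \sum_(s : T.-tuple 'I_N) pot s <= N%:R ^+ T * (m%:R * B ^+ 2).
  have -> : N%:R ^+ T * (m%:R * B ^+ 2)
      = \sum_(s : T.-tuple 'I_N) m%:R * B ^+ 2.
    by rewrite sumr_const card_tuple card_ord -natrX mulr_natl.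
  by apply: ler_sum => s _; rewrite gerBl dotv_ge0.
have k0 : 0 <= q / (2 * K) by rewrite divr_ge0 ?mulr_ge0// ltW.
move=> /(ler_wpM2l k0) hpot htot.
rewrite -(ler_pM2l (exprn_gt0 2 q0)).
have -> : q ^+ 2 * (N%:R ^+ T * (D / q))
    = N%:R ^+ T * (K * L2 * q) + q / (2 * K) * (N%:R ^+ T * (m%:R * B ^+ 2)).
  by field; rewrite !gt_eqF.
by lra.
Qed.

(** The l^1 error is at most [sqrt (2 gap / sigma)] for each history. Instead of
    averaging square roots, bound each of them by its tangent at the bound for
    the average gap: with [r] the final bound,
    [|z| <= (N / r * z ^+ 2 + r / N) / 2]. *)
Lemma sgd_demand_error (T : nat) : (0 < T)%N ->
  \sum_(s : T.-tuple 'I_N) \sum_(i < N)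
    `|reaction A u i opt - reaction A u i (avg T s)|
  <= N%:R ^+ T * (Num.sqrt (2 * D / sigma) * (T%:R `^ 4^-1)^-1).
Proof.
move=> T0; set r := Num.sqrt _ * _.
have L0 : 0 <= L2 by apply: sumr_ge0 => j _; exact: sqr_ge0.
have D0 : 0 < D.
  apply: ltr_pwDl; last by rewrite mulr_ge0// ltW.
  have ? : 0 < m%:R :> R by rewrite ltr0n.
  by rewrite divr_gt0 ?mulr_gt0// exprn_gt0.
have r0 : 0 < r.
  by rewrite mulr_gt0 ?sqrtr_gt0 ?divr_gt0 ?mulr_gt0// invr_gt0 powR_gt0 ?ltr0n.
have root4 : (T%:R `^ 4^-1) ^+ 2 = Num.sqrt T%:R :> R.
  rewrite -powR_mulrn ?powR_ge0// -powRrM -powR12_sqrt ?ler0n//.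
  by congr (_ `^ _); field.
have rr : r ^+ 2 = 2 / sigma * (D / Num.sqrt T%:R).
  rewrite exprMn sqr_sqrtr ?divr_ge0 ?mulr_ge0 ?(ltW D0) ?(ltW sigma0)//.
  by rewrite exprVn root4; ring.
have tangent (z : R) : `|z| <= N%:R / (2 * r) * z ^+ 2 + r / (2 * N%:R).
  have : 0 <= (N%:R * `|z| - r) ^+ 2 / (2 * N%:R * r).
    by rewrite divr_ge0 ?sqr_ge0// !mulr_ge0// ltW.
  rewrite sqrrB exprMn real_normK ?num_real//.
  have -> : (N%:R ^+ 2 * z ^+ 2 - N%:R * `|z| * r *+ 2 + r ^+ 2) / (2 * N%:R * r)
     = N%:R / (2 * r) * z ^+ 2 + r / (2 * N%:R) - `|z|.
    by field; rewrite !gt_eqF.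
  by rewrite subr_ge0.
have err (s : T.-tuple 'I_N) :
    \sum_(i < N) `|reaction A u i opt - reaction A u i (avg T s)|
    <= (sigma * r)^-1 * gap (avg T s) + r / 2.
  apply: le_trans (ler_sum _ (fun i _ => tangent _)) _.
  rewrite big_split/= -big_distrr/= sumr_const card_ord.
  rewrite -[r / (2 * N%:R) *+ N]mulr_natl.
  have := reactions_error A b u B _ eps A01 b0 B0 c0 eps0 uC2 du0 d2u opt bopt mopt
    _ (average_nonneg T s).
  move: (\sum_(i < N) _) (gap _) => S g Sg.
  have k0 : 0 <= (sigma * r)^-1 by rewrite invr_ge0 mulr_ge0// ltW.
  have := ler_wpM2l k0 Sg.
  have -> : (sigma * r)^-1 * (N%:R * sigma / 2 * S) = N%:R / (2 * r) * S.
    by field; rewrite !gt_eqF.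
  have -> : N%:R * (r / (2 * N%:R)) = r / 2 by field; rewrite gt_eqF.
  by lra.
apply: le_trans (ler_sum _ (fun s _ => err s)) _.
rewrite big_split/= -big_distrr/= sumr_const card_tuple card_ord.
rewrite -[_ *+ (N ^ T)]mulr_natl natrX.
have k0 : 0 <= (sigma * r)^-1 by rewrite invr_ge0 mulr_ge0// ltW.
have := ler_wpM2l k0 (sgd_average_gap T T0).
have -> : (sigma * r)^-1 * (N%:R ^+ T * (D / Num.sqrt T%:R)) = N%:R ^+ T * (r / 2).
  have -> : D / Num.sqrt T%:R = r ^+ 2 * (sigma / 2).
    by rewrite rr; move: (D / _) => z; field; rewrite gt_eqF.
  by field; rewrite !gt_eqF.
by lra.
Qed.

End Descent.

(** * The law of the draws *)

(** All randomness of the first [n.+1] iterates: the draws numbered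
    [2, ..., n.+1], newest first. *)
Fixpoint history {Omega I : Type} (xi : nat -> Omega -> I) (n : nat) (w : Omega) :
    seq I :=
  if n is k.+1 then xi k.+2 w :: history xi k w else [::].

Lemma size_history {Omega I : Type} (xi : nat -> Omega -> I) n w :
  size (history xi n w) = n.
Proof. by elim: n => //= n ->. Qed.

Lemma expectation_finite {R : realType} {d : measure_display}
    {Omega : measurableType d} (P : probability Omega R) (E : finType)
    (X : Omega -> E) (F : E -> R) :
  (forall e, measurable (X @^-1` [set e])) ->
  ('E_P[fun w => F (X w)] = \sum_(e : E) (F e)%:E * P (X @^-1` [set e]))%E.
Proof.
move=> mX; rewrite unlock.
transitivity (\int[P]_w \sum_(e : E) (F e)%:E * (\1_(X @^-1` [set e]) w)%:E)%E.
  apply: eq_integral => w _; rewrite (bigD1 (X w))//= big1 ?adde0.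
    by rewrite indicE mem_set// mule1.
  by move=> e /eqP eX; rewrite indicE memNset ?mule0//= => /esym.
rewrite integral_sum//; last by move=> e; apply/integrableZl/integrable_indic.
apply: eq_bigr => e _; rewrite integralZl//; last exact: integrable_indic.
by rewrite integral_indic// setIT.
Qed.

Section Law.
Context {R : realType} {d : measure_display} {Omega : measurableType d}.
Variables (P : probability Omega R) (N : nat) (xi : nat -> Omega -> 'I_N).
Hypothesis N0 : (0 < N)%N.
Hypothesis xi_meas : forall r, (1 <= r)%N -> finite_random_element (xi r).
Hypothesis xi_indep : mutually_independent P [set r : nat | (1 <= r)%N] xi.
Hypothesis xi_unif : forall r, (1 <= r)%N -> uniformly_distributed P (xi r).

Let draws (n : nat) : {fset nat} := [fset r in iota 2 n]%fset.
(* The draw [r] is the entry [n + 1 - r] of the history, as the newest draw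
   [n + 1] comes first. *)
Let value (n : nat) (s : seq 'I_N) (r : nat) : set 'I_N :=
  [set nth (Ordinal N0) s (n.+1 - r)].

Lemma mem_draws n r : (r \in draws n) = (1 < r <= n.+1)%N.
Proof. by rewrite /draws inE mem_iota; lia. Qed.

Lemma history_event n (s : seq 'I_N) : size s = n ->
  [set w | history xi n w = s]
  = \bigcap_(r in [set` draws n]) (xi r @^-1` value n s r).
Proof.
move=> ss; apply/seteqP; split=> w /=.
  elim: n s ss => [|n IH] [|i s]//= ss; first by move=> _ r; rewrite /= mem_draws; lia.
  move=> [<- hs] r; rewrite /= mem_draws => rn; rewrite /value/=.
  have [->|rn'] := eqVneq r n.+2; first by rewrite subnn.
  have rn1 : (1 < r <= n.+1)%N by lia.
  rewrite subSn/=; last by lia.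
  by case: ss => ss; have := IH s ss hs r; rewrite /= mem_draws => /(_ rn1).
elim: n s ss => [|n IH] [|i s]//= ss h; congr (_ :: _).
  by have := h n.+2; rewrite /= mem_draws /value/= subnn; apply; lia.
apply: IH; first by case: ss.
move=> r; rewrite /= mem_draws => rn.
have := h r; rewrite /= mem_draws /value subSn; last by lia.
by apply; lia.
Qed.

Lemma draws_ge1 n r : r \in draws n -> (1 <= r)%N.
Proof. by rewrite mem_draws; lia. Qed.

Lemma history_measurable n (s : seq 'I_N) : size s = n ->
  measurable [set w | history xi n w = s].
Proof.
move=> ss; rewrite history_event//; apply: fin_bigcap_measurable.
  exact: finite_fset.
by move=> r /= /draws_ge1 r1; exact: xi_meas.
Qed.

(** Independence makes the probability a product of [n] factors [1 / N]. *)
Lemma history_uniform n (s : seq 'I_N) : size s = n ->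
  P [set w | history xi n w = s] = ((N%:R ^+ n)^-1)%:E.
Proof.
move=> ss; rewrite history_event// xi_indep; last by move=> r /= /draws_ge1.
rewrite (eq_big_seq (fun=> (N%:R^-1)%:E)); last first.
  by move=> r /draws_ge1 r1; rewrite xi_unif// card_ord.
rewrite prodEFin big_const_seq count_predT iter_mulr_1 exprVn.
congr ((_ ^+ _)^-1%R)%:E.
by rewrite card_fseq undup_id ?iota_uniq// size_iota.
Qed.

Lemma expectation_history n (F : seq 'I_N -> R) :
  'E_P[fun w => F (history xi n w)]%E
  = ((N%:R ^+ n)^-1 * \sum_(s : n.-tuple 'I_N) F s)%:E.
Proof.
pose X w : n.-tuple 'I_N := Tuple (introT eqP (size_history xi n w)).
have XE (s : n.-tuple 'I_N) :
    X @^-1` [set s] = [set w | history xi n w = s].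
  by apply/seteqP; split=> w /= [h]; [rewrite -h|apply: val_inj].
rewrite (expectation_finite P _ X (fun s => F s)); last first.
  by move=> s; rewrite XE; apply: history_measurable; rewrite size_tuple.
rewrite big_distrr/= -sumEFin; apply: eq_bigr => s _.
by rewrite XE history_uniform ?size_tuple// -EFinM mulrC.
Qed.

End Law.

(** * Convergence in expectation *)

Theorem theorem1 (R : realType) (m N : nat)
    (A : 'M[R]_(m, N)) (b : 'cV[R]_m) (u : 'I_N -> R -> R)
    (B sigma eps K : R)
    (d : measure_display) (Omega : measurableType d) (P : probability Omega R)
    (xi : nat -> Omega -> 'I_N)
    (lambda1 : 'cV[R]_m) (lambda : nat -> Omega -> 'cV[R]_m)
    (* network *)
    (hm : (1 <= m)%N) (hN : (1 <= N)%N)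
    (hA01 : forall j i, A j i = 0 \/ A j i = 1)
    (hA0 : forall i, col i A <> 0)
    (hb : forall j, 0 < b j 0)
    (* utility functions *)
    (hB : 0 < B) (hsigma : 0 < sigma) (heps : 0 < eps)
    (hC2 : forall i, C2_on [set y : R | - eps < y] (u i))
    (hu0 : forall i, u i 0 = 0)
    (hdu0 : forall i, 0 < (u i)^`() 0 <= B)
    (hd2u : forall i (y : R), 0 <= y -> N%:R * sigma <= - (u i)^`(2)%classic y)
    (* random choice of users *)
    (hxi_meas : forall r, (1 <= r)%N -> finite_random_element (xi r))
    (hxi_indep : mutually_independent P [set r : nat | (1 <= r)%N] xi)
    (hxi_unif : forall r, (1 <= r)%N -> uniformly_distributed P (xi r))
    (* projected stochastic gradient descent *)
    (hK : 0 < K)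
    (hlambda1 : box B lambda1)
    (hinit : forall w, lambda 1%N w = lambda1)
    (hstep : forall t w, (1 <= t)%N ->
      lambda t.+1 w =
        orth_proj (box B)
          (lambda t w - (K / Num.sqrt t%:R) *:
            (b - (N%:R * reaction A u (xi t.+1 w) (lambda t w))
                   *: col (xi t.+1 w) A))) :
  let L : R :=
    Num.sqrt (\sum_(j < m) Num.max (b j 0) (B / sigma - b j 0) ^+ 2) in
  let D : R := m%:R * B ^+ 2 / (2 * K) + K * L ^+ 2 in
  let lambda_avg (T : nat) (w : Omega) : 'cV[R]_m :=
    T%:R^-1 *: \sum_(1 <= t < T.+1) lambda t w in
  forall T : nat, (1 <= T)%N ->
    (forall j : 'I_m,
      ('E_P[fun w => Num.max
              (\sum_(i < N) A j i * reaction A u i (lambda_avg T w) - b j 0)%R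
              0%R]
       <= (Num.sqrt (2 * D / sigma) * (T%:R `^ 4^-1)^-1)%:E)%E)
    /\ ((total_utility u (primal_opt A b u))%:E
          - 'E_P[fun w => total_utility u (reactions A u (lambda_avg T w))]
        <= (B * Num.sqrt (2 * D / sigma) * (T%:R `^ 4^-1)^-1)%:E)%E.
Proof.
move=> L D lambda_avg T T0.
have du0 i : (u i)^`() 0 <= B by have /andP[] := hdu0 i.
have c0 : 0 < N%:R * sigma by rewrite mulr_gt0 ?ltr0n.
have [opt bopt mopt] := dual_minimizer_exists A b u B _ eps hA01 hB c0 heps hC2 du0 hd2u.
pose avg (s : seq 'I_N) : 'cV[R]_m :=
  T%:R^-1 *: \sum_(l <- past_iterates (sgd_step A b u B K) lambda1 s) l.
have lambdaE t w : lambda t.+1 w = iterate (sgd_step A b u B K) lambda1 (history xi t w).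
  elim: t => [|t IH]; first exact: hinit.
  rewrite (hstep t.+1 w isT) IH [RHS]/= size_history; reflexivity.
have avgE w : lambda_avg T w = avg (history xi T w).
  rewrite /lambda_avg /avg; congr (_ *: _).
  elim: {T0 avg} T => [|t IH]; first by rewrite big_geq//= big_nil.
  by rewrite big_nat_recr//= IH big_cons lambdaE addrC.
have avg0 s : nonnegv (avg s) by exact: average_nonneg.
have NT0 : 0 < N%:R ^+ T :> R by rewrite exprn_gt0 ?ltr0n.
set r := Num.sqrt (2 * D / sigma) * (T%:R `^ 4^-1)^-1.
have err : \sum_(s : T.-tuple 'I_N) \sum_(i < N)
    `|reaction A u i opt - reaction A u i (avg s)| <= N%:R ^+ T * r.
  have := sgd_demand_error A b u B sigma eps K opt lambda1 hA01 hb hm hN hB hsigma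
    heps hK hC2 du0 hd2u bopt hlambda1 mopt T T0.
  by rewrite /r /D /L sqr_sqrtr// sumr_ge0// => j _; exact: sqr_ge0.
split=> [j|].
- under [X in ('E_P[X] <= _)%E]eq_fun do rewrite avgE.
  rewrite (expectation_history P N xi hN hxi_meas hxi_indep hxi_unif T (fun s =>
    Num.max (\sum_(i < N) A j i * reaction A u i (avg s) - b j 0) 0)).
  rewrite lee_fin mulrC ler_pdivrMr// mulrC; apply: le_trans err.
  apply: ler_sum => s _; rewrite ge_max sumr_ge0// andbT.
  exact: (link_overload A b u B _ eps hA01 hb hB c0 heps hC2 du0 hd2u opt bopt mopt).
- under [X in (_ - 'E_P[X] <= _)%E]eq_fun do rewrite avgE.
  rewrite (expectation_history P N xi hN hxi_meas hxi_indep hxi_unif T (fun s =>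
    total_utility u (reactions A u (avg s)))).
  rewrite -EFinB lee_fin -mulrA -/r.
  have : \sum_(s : T.-tuple 'I_N) (total_utility u (primal_opt A b u)
      - total_utility u (reactions A u (avg s))) <= B * (N%:R ^+ T * r).
    apply: le_trans (ler_wpM2l (ltW hB) err); rewrite big_distrr/=.
    apply: ler_sum => s _.
    exact: (utility_shortfall A b u B _ eps hA01 hb hB c0 heps hC2 du0 hd2u
      opt bopt mopt).
  rewrite sumrB sumr_const card_tuple card_ord -[_ *+ (N ^ T)]mulr_natl natrX.
  move: (\sum_(s : T.-tuple 'I_N) _) (total_utility u _) => S U h.
  by rewrite -(ler_pM2l NT0) mulrBr mulVKf ?gt_eqF// mulrCA.
Qed.
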